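(* Let $k$ be a field of characteristic $0$. The set $$\overline{S}:=X\cup\{u'\mid u\in B,\ \mathrm{wt}(u)=-2\}$$ is a basis of the vector space $\overline{ST}\langle X\rangle$. Moreover, for every $n\ge 2$, $$\dim\overline{ST}^{\mathrm{mult}}_n=n\binom{2n-3}{n-1},$$ where $\overline{ST}^{\mathrm{mult}}_n$ is the subspace of elements of $\overline{ST}\langle X\rangle$ that are multilinear of degree $n$ in $x_1,\dots,x_n$.
   Context: A perm algebra is an associative algebra satisfying $(ab)c=(ba)c$. $\mathrm{DerPerm}\langle X\rangle$ is the free differential perm algebra on $X=\{x_1,x_2,\dots\}$ over $k$: the free perm algebra generated by the symbols $x^{(s)}$ ($x\in X$, $s\ge0$, $x^{(0)}=x$) with derivation $d$ (written $a'=d(a)$) determined by $d(x^{(s)})=x^{(s+1)}$ and the Leibniz rule. $B$ is its standard basis, consisting of the monomials $x_{k_1}^{(i_1)}\cdots x_{k_{n-1}}^{(i_{n-1})}x_{k_n}^{(i_n)}$ with $n\ge1$, $k_1\le\dots\le k_{n-1}$, $k_n$ arbitrary, $i_j\ge 0$ (the first $n-1$ factors commute; monomials are identified when equal as elements). The degree of such a monomial is $n$ and its weight is $\mathrm{wt}=\sum_{j=1}^n(i_j-1)$. A monomial is multilinear in $x_1,\dots,x_n$ if $\{k_1,\dots,k_n\}=\{1,\dots,n\}$, with arbitrary derivative orders. $\overline{ST}\langle X\rangle$ is the smallest linear subspace of $\mathrm{DerPerm}\langle X\rangle$ containing $X$ and closed under the product $a\bullet b:=a'b+ab'$. *)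

(* Defs.v *)
From HB Require Import structures.
From mathcomp Require Import all_boot all_order all_algebra.
From mathcomp Require Import finmap multiset.
From mathcomp.multinomials Require Import monalg.

Set Implicit Arguments.
Unset Strict Implicit.
Unset Printing Implicit Defensive.

Import Order.TTheory GRing.Theory Num.Theory.

Local Open Scope fset_scope.
Local Open Scope mset_scope.
Local Open Scope ring_scope.

(* Linear independence, span, basis and dimension for subsets of a vector
   space that need not be finite-dimensional; subsets are predicates. *)

Section Bases.
Variables (k : fieldType) (V : lmodType k).
Implicit Types (S W : V -> Prop).

Definition subspace W :=
  [/\ W 0, (forall u v, W u -> W v -> W (u + v))
         & (forall (c : k) v, W v -> W (c *: v))].

Definition lin_indep S :=
  forall (s : seq V) (c : V -> k),
    uniq s -> (forall v, v \in s -> S v) ->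
    \sum_(v <- s) c v *: v = 0 -> forall v, v \in s -> c v = 0.

Definition lspan S (w : V) :=
  exists (s : seq V) (c : V -> k),
    (forall v, v \in s -> S v) /\ w = \sum_(v <- s) c v *: v.

Definition is_basis S W := lin_indep S /\ (forall w, W w <-> lspan S w).

Definition has_dim W (N : nat) :=
  exists s : N.-tuple V, uniq s /\ is_basis (fun v => v \in s) W.

End Bases.

Section LinExt.
Variables (k : fieldType) (K : choiceType) (V : lmodType k).

Definition lin_ext (h : K -> V) (f : {malg k[K]}) : V :=
  \sum_(u <- msupp f) f@_u *: h u.

Lemma lin_extEw h f (D : {fset K}) :
  (msupp f `<=` D)%fset -> lin_ext h f = \sum_(u <- D) f@_u *: h u.
Proof.
move=> sD; rewrite /lin_ext (big_fset_incl _ sD) // => u _ /mcoeff_outdom ->.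
by rewrite scale0r.
Qed.

Lemma lin_ext_is_linear h : linear (lin_ext h).
Proof.
move=> c f g.
pose D := (msupp (c *: f + g) `|` (msupp f `|` msupp g))%fset.
have [s1 s2 s3] : [/\ (msupp (c *: f + g) `<=` D)%fset, (msupp f `<=` D)%fset
                    & (msupp g `<=` D)%fset].
  by split; apply/fsubsetP => u hu; rewrite !inE hu ?orbT.
rewrite (lin_extEw _ s1) (lin_extEw _ s2) (lin_extEw _ s3).
rewrite scaler_sumr -big_split /=; apply: eq_bigr => u _.
by rewrite mcoeffD mcoeffZ scalerDl scalerA.
Qed.

HB.instance Definition _ h :=
  GRing.isLinear.Build k {malg k[K]} V *:%R (lin_ext h) (lin_ext_is_linear h).

Lemma lin_extU h u : lin_ext h << u >> = h u.
Proof. by rewrite /lin_ext msuppU oner_eq0 big_seq_fset1 mcoeffUU scale1r. Qed.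

Lemma malg_lin_eq (p q : {malg k[K]} -> V) :
  linear p -> linear q -> (forall u, p << u >> = q << u >>) -> p =1 q.
Proof.
move=> pl ql H f.
pose P := HB.pack_for {linear {malg k[K]} -> V} p
  (GRing.isLinear.Build k {malg k[K]} V *:%R p pl).
pose Q := HB.pack_for {linear {malg k[K]} -> V} q
  (GRing.isLinear.Build k {malg k[K]} V *:%R q ql).
rewrite (_ : p = P) // (_ : q = Q) //.
rewrite (monalgE f) !linear_sum; apply: eq_bigr => u _.
suff -> : << f@_u *g u >> = f@_u *: << u >> :> {malg k[K]}.
  by rewrite !linearZ /= H.
by apply/malgP => v; rewrite mcoeffZ !mcoeffU mulrnAr mulr1.
Qed.

End LinExt.

Section DerPermAlgebras.
Variables (k : fieldType) (A : lmodType k) (m : A -> A -> A) (d : A -> A).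

Record der_perm_algebra : Prop := DerPermAlgebra {
  dpa_linl : forall b, linear (m^~ b);
  dpa_linr : forall a, linear (m a);
  dpa_assoc : forall a b c, m (m a b) c = m a (m b c);
  dpa_perm : forall a b c, m (m a b) c = m (m b a) c;
  dpa_lind : linear d;
  dpa_leibniz : forall a b, d (m a b) = m (d a) b + m a (d b) }.

End DerPermAlgebras.

(* [(i, s) : letter] is the generator x_(i+1)^(s): the variables x_1, x_2, ...
   are numbered from 0. *)
Definition letter := (nat * nat)%type.

(* The monomial a_1 ... a_(n-1) a_n, in which the first n - 1 factors commute,
   is the pair of the multiset {a_1, ..., a_(n-1)} and the last letter a_n. *)
Definition monom := ({mset letter} * letter)%type.
HB.instance Definition _ := Choice.on monom.

Section Monomials.
Implicit Types (a : letter) (u v : monom).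

Definition letters u : seq letter := rcons u.1 u.2.

Definition degree u : nat := size (letters u).

Definition wt u : int := \sum_(a <- letters u) (a.2%:Z - 1).

Definition multilinear (n : nat) u : Prop :=
  degree u = n /\ [seq a.1 | a <- letters u] =i [pred i | (i < n)%N].

Definition mulm u v : monom := (u.1 `+` (u.2 +` v.1), v.2).

Definition dletter a : letter := (a.1, a.2.+1).

End Monomials.

Definition DerPerm (k : fieldType) := {malg k[monom]}.
HB.instance Definition _ (k : fieldType) := GRing.Lmodule.on (DerPerm k).

Section FreeDerPerm.
Variable k : fieldType.
Implicit Types (a : letter) (u v w : monom) (f g h : DerPerm k).

Definition mon u : DerPerm k := << u >>.

Definition gen a : DerPerm k := mon (mset0, a).

Definition X (i : nat) : DerPerm k := gen (i, 0%N).

Definition mul f g : DerPerm k :=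
  lin_ext (fun u => lin_ext (fun v => mon (mulm u v)) g) f.

(* The sum over [a <- u.1] counts multiplicities. *)
Definition derm u : DerPerm k :=
  \sum_(a <- u.1) mon (dletter a +` (u.1 `\ a), u.2) + mon (u.1, dletter u.2).

Definition der : DerPerm k -> DerPerm k := lin_ext derm.

Definition bullet f g : DerPerm k := mul (der f) g + mul f (der g).

Definition ST f : Prop :=
  forall W : DerPerm k -> Prop,
    subspace W -> (forall i, W (X i)) ->
    (forall g h, W g -> W h -> W (bullet g h)) -> W f.

Definition Sbar f : Prop :=
  (exists i, f = X i) \/ (exists u, wt u = - 2%:Z /\ f = der (mon u)).

Definition STmult (n : nat) f : Prop :=
  ST f /\ (forall u, u \in msupp f -> multilinear n u).

(* The construction is the free differential perm algebra on X, and [mon u] is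
   the product of the letters of u. *)

Lemma lin_eq2 (V : lmodType k) (p q : DerPerm k -> DerPerm k -> V) :
  (forall g, linear (p^~ g)) -> (forall f, linear (p f)) ->
  (forall g, linear (q^~ g)) -> (forall f, linear (q f)) ->
  (forall u v, p (mon u) (mon v) = q (mon u) (mon v)) -> p =2 q.
Proof.
move=> pl pr ql qr H f g.
apply: (malg_lin_eq (pl g) (ql g)) => u.
by apply: (malg_lin_eq (pr _) (qr _)) => v; apply: H.
Qed.

Lemma mul_linl g : linear (mul^~ g).
Proof. exact: lin_ext_is_linear. Qed.

Lemma mul_linr f : linear (mul f).
Proof.
move=> c g h; rewrite /mul /lin_ext scaler_sumr -big_split /=.
apply: eq_bigr => u _; rewrite -/(lin_ext _ _) -/(lin_ext _ g) -/(lin_ext _ h).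
by rewrite linearP scalerDr !scalerA mulrC.
Qed.

Lemma der_lin : linear der.
Proof. exact: lin_ext_is_linear. Qed.

Lemma mul_mon u v : mul (mon u) (mon v) = mon (mulm u v).
Proof. by rewrite /mul /mon !lin_extU. Qed.

Lemma der_mon u : der (mon u) = derm u.
Proof. exact: lin_extU. Qed.

Lemma mulm_assoc u v w : mulm (mulm u v) w = mulm u (mulm v w).
Proof. by rewrite /mulm /= !msetDA. Qed.

Lemma mulm_perm u v w : mulm (mulm u v) w = mulm (mulm v u) w.
Proof.
congr (_, _); apply/msetP => x; rewrite /= !msetE2.
by rewrite (AC (1*2*2) (3*(4*1)*(2*5))).
Qed.

Lemma perm_enum_msetD (K : choiceType) (A B : {mset K}) :
  perm_eq (A `+` B) ((A : seq K) ++ B).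
Proof.
by apply/allP => x _ /=; rewrite count_cat !count_mem_mset msetE2.
Qed.

Lemma big_msetD (K : choiceType) (V : nmodType) (A B : {mset K}) (F : K -> V) :
  \sum_(x <- A `+` B) F x = \sum_(x <- A) F x + \sum_(x <- B) F x.
Proof. by rewrite (perm_big _ (perm_enum_msetD A B)) big_cat. Qed.

Lemma big_mset1 (K : choiceType) (V : nmodType) (a : K) (F : K -> V) :
  \sum_(x <- [mset a]) F x = F a.
Proof. by rewrite enum_msetn big_cons big_nil addr0. Qed.

Lemma msetDB1 (K : choiceType) (A B : {mset K}) (a : K) :
  a \in A -> (A `+` B) `\ a = (A `\ a) `+` B.
Proof. by move=> aA; rewrite -{1}(msetB1K aA) -msetDA msetD1K. Qed.

Lemma lin_sum (V : lmodType k) (p : DerPerm k -> V) (I : Type) (r : seq I)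
    (F : I -> DerPerm k) :
  linear p -> p (\sum_(i <- r) F i) = \sum_(i <- r) p (F i).
Proof.
move=> pl.
pose P := HB.pack_for {linear (DerPerm k) -> V} p
  (GRing.isLinear.Build k (DerPerm k) V *:%R p pl).
exact: (linear_sum P).
Qed.

Lemma lin_add (V : lmodType k) (p : DerPerm k -> V) f g :
  linear p -> p (f + g) = p f + p g.
Proof. by move=> pl; have := pl 1 f g; rewrite !scale1r. Qed.

Lemma derm_leibniz u v :
  derm (mulm u v) = mul (derm u) (mon v) + mul (mon u) (derm v).
Proof.
case: u v => [U a] [V b]; rewrite /derm /mulm /=.
rewrite !big_msetD big_mset1.
rewrite (lin_add _ _ (mul_linl _)) (lin_add _ _ (mul_linr _)) mul_mon.
rewrite (lin_sum _ _ (mul_linl (mon _))) (lin_sum _ _ (mul_linr (mon _))).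
have -> : \sum_(c <- U) mul (mon (dletter c +` U `\ c, a)) (mon (V, b)) =
  \sum_(c <- U) mon (dletter c +` (U `+` (a +` V)) `\ c, b).
  rewrite !big_seq; apply: eq_bigr => c cU.
  by rewrite mul_mon /mulm [_.1]/= [_.2]/= (msetDB1 _ cU) -!msetDA.
have -> : \sum_(c <- V) mul (mon (U, a)) (mon (dletter c +` V `\ c, b)) =
  \sum_(c <- V) mon (dletter c +` (U `+` (a +` V)) `\ c, b).
  rewrite !big_seq; apply: eq_bigr => c cV; rewrite mul_mon /mulm [_.1]/= [_.2]/=.
  have -> // : U `+` (a +` (dletter c +` V `\ c)) = dletter c +` (U `+` (a +` V)) `\ c.
  have -> : U `+` (a +` V) = V `+` (U `+` [mset a]) by rewrite msetDA msetDC.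
  rewrite (msetDB1 _ cV); apply/msetP => x; rewrite !msetE2.
  by rewrite (AC (1*(1*(1*1))) (3*(4*(1*2)))).
rewrite (mul_mon (U, a)) /mulm [_.1]/= [_.2]/=.
have -> : dletter a +` (U `+` (a +` V)) `\ a = U `+` (dletter a +` V).
  by rewrite [U `+` _]msetDCA msetD1K msetDCA.
by rewrite !addrA.
Qed.

Lemma DerPerm_axioms : der_perm_algebra (@mul) der.
Proof.
have ml := mul_linl; have mr := mul_linr; have dl := der_lin.
split; [exact: ml|exact: mr| | |exact: dl|].
- move=> f g h; move: f g.
  apply: lin_eq2 => [g c f1 f2|f c f1 f2|g c f1 f2|f c f1 f2|u v].
  + by rewrite (ml g) (ml h).
  + by rewrite (mr f) (ml h).
  + by rewrite (ml (mul g h)).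
  + by rewrite (ml h) (mr f).
  have H : linear (fun h => mul (mon u) (mul (mon v) h)).
    by move=> c f1 f2; rewrite (mr (mon v)) (mr (mon u)).
  apply: (malg_lin_eq (mr (mul (mon u) (mon v))) H) => w.
  by rewrite -/(mon w) !mul_mon mulm_assoc.
- move=> f g h; move: f g.
  apply: lin_eq2 => [g c f1 f2|f c f1 f2|g c f1 f2|f c f1 f2|u v].
  + by rewrite (ml g) (ml h).
  + by rewrite (mr f) (ml h).
  + by rewrite (mr g) (ml h).
  + by rewrite (ml f) (ml h).
  apply: (malg_lin_eq (mr _) (mr _)) => w.
  by rewrite -/(mon w) !mul_mon mulm_perm.
- apply: lin_eq2 => [g c f1 f2|f c f1 f2|g c f1 f2|f c f1 f2|u v].
  + by rewrite (ml g) dl.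
  + by rewrite (mr f) dl.
  + by rewrite dl !(ml _ c) scalerDr addrACA.
  + by rewrite dl !(mr _ c) scalerDr addrACA.
  by rewrite mul_mon !der_mon derm_leibniz.
Qed.

Lemma der_gen a : der (gen a) = gen (dletter a).
Proof. by rewrite der_mon /derm big_mset0 add0r. Qed.

Lemma mon_prod (s : seq letter) a :
  mon (seq_mset s, a) = foldr (fun b f => mul (gen b) f) (gen a) s.
Proof.
elim: s => [|b s IH] /=.
  congr (mon (_, _)); apply/msetP => x; by rewrite mset_seqE mset0E.
rewrite -IH mul_mon; congr (mon (_, _)); apply/msetP => x /=.
by rewrite mset_seqE !msetE2 mset0E mset_seqE msetnE /= eq_sym; case: eqP.
Qed.

Lemma DerPerm_free (A : lmodType k) (m : A -> A -> A) (d : A -> A)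
    (x : nat -> A) :
  der_perm_algebra m d ->
  let is_ext (phi : DerPerm k -> A) :=
    [/\ linear phi, forall f g, phi (mul f g) = m (phi f) (phi g),
        forall f, phi (der f) = d (phi f) & forall i, phi (X i) = x i] in
  exists phi : DerPerm k -> A,
    is_ext phi /\ forall psi, is_ext psi -> psi =1 phi.
Proof.
move=> [ml mr mA mP dl dL] is_ext.
pose y (a : letter) := iter a.2 d (x a.1).
pose h (b : letter) (z : A) := m (y b) z.
pose pr (s : seq letter) a := foldr h (y a) s.
have hC b c z : h b (h c z) = h c (h b z) by rewrite /h -!mA mP.
have hF b z s : foldr h (h b z) s = h b (foldr h z s).
  by elim: s => //= c s ->; rewrite hC.
have hA z (w : A) s : m (foldr h z s) w = foldr h (m z w) s.
  by elim: s => //= b s <-; rewrite /h mA.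
have hFF s t z : foldr h (foldr h z s) t = foldr h (foldr h z t) s.
  by elim: t => //= b t ->; rewrite hF.
have prP s t a : perm_eq s t -> pr s a = pr t a.
  apply: catCA_perm_subst => s1 s2 s3.
  by rewrite /pr !foldr_cat hFF.
pose phi := lin_ext (fun u : monom => pr u.1 u.2).
have phil : linear phi by apply: lin_ext_is_linear.
have phim u : phi (mon u) = pr u.1 u.2 by apply: lin_extU.
have phiM : {morph phi : f g / mul f g >-> m f g}.
  have mull := mul_linl; have mulr := mul_linr.
  apply: lin_eq2 => [g c f1 f2|f c f1 f2|g c f1 f2|f c f1 f2|u v].
  - by rewrite (mull g) phil.
  - by rewrite (mulr f) phil.
  - by rewrite phil (ml (phi g)).
  - by rewrite phil (mr (phi f)).
  rewrite mul_mon !phim /mulm [_.1]/= [_.2]/=.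
  rewrite (prP _ _ _ (perm_enum_msetD _ _)) /pr foldr_cat hA.
  have pe : perm_eq (u.2 +` v.1) (u.2 :: v.1).
    by apply: (perm_trans (perm_enum_msetD _ _)); rewrite enum_msetn.
  by rewrite -/(pr (u.2 +` v.1) v.2) (prP _ _ _ pe).
have phig a : phi (gen a) = y a by rewrite phim /pr enum_mset0.
have phiD : {morph phi : f / der f >-> d f}.
  move=> f; apply: (@malg_lin_eq _ _ _ (phi \o der) (d \o phi)) => [c f1 f2|c f1 f2|u].
  - by rewrite /= der_lin phil.
  - by rewrite /= phil dl.
  rewrite /= -/(mon u); case: u => U a; rewrite -(seq_mset_id U) mon_prod.
  elim: (U : seq letter) => [|b s IH] /=; first by rewrite der_gen !phig.
  rewrite (dpa_leibniz DerPerm_axioms) (lin_add _ _ phil) !phiM IH dL.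
  by rewrite der_gen !phig.
exists phi; split; first by split=> // i; rewrite phig.
move=> psi [psil psiM psiD psiX].
have psig a : psi (gen a) = y a.
  case: a => i; elim=> [|s IH]; first exact: psiX.
  by rewrite -[(i, s.+1)]/(dletter (i, s)) -der_gen psiD IH.
apply: (malg_lin_eq psil phil) => u; rewrite -/(mon u).
case: u => U a; rewrite -(seq_mset_id U) mon_prod.
by elim: (U : seq letter) => [|b s IH] /=; rewrite ?psiM ?phiM ?psig ?phig ?IH.
Qed.

End FreeDerPerm.

(* Main.v *)
(* Since a • b = (ab)', the space ST is contained in the span of X and of the
   u' with wt u = -2. For the converse, one shows by induction on the degree
   that u' is in ST for every monomial u of weight -2. Write f = 0 when f' is in
   ST; then f = 0 whenever f is a product of two elements of ST. The position
   of the last factor plays no role in the relations used, so monomials are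
   words with one flagged letter, and, x and y denoting letters of order 0, the
   relations are x . v' = 0 (v of weight -2) and (x y)' v' = 0. They show that
   a word with a letter of order 2, then of any order >= 2, is 0; in the
   remaining words, with letters of order at most 1, three relations give
   2 u = 0. Independence holds because (U, a)' contains (U, a') and otherwise
   only monomials with last factor a. *)
From HB Require Import structures.
From mathcomp Require Import all_boot all_order all_algebra.
From mathcomp Require Import finmap multiset zify.
From mathcomp.multinomials Require Import monalg.
Require Import Defs.

Set Implicit Arguments.
Unset Strict Implicit.
Unset Printing Implicit Defensive.

Import Order.TTheory GRing.Theory Num.Theory.

Local Open Scope mset_scope.
Local Open Scope ring_scope.

(** * Subspaces and linear spans given as predicates *)

Section Subspaces.
Variables (k : fieldType) (V : lmodType k) (W : V -> Prop).
Hypothesis sW : subspace W.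

Lemma subspaceD u v : W u -> W v -> W (u + v).
Proof. by case: sW => _ WD _; apply: WD. Qed.

Lemma subspaceZ (c : k) v : W v -> W (c *: v).
Proof. by case: sW => _ _; apply. Qed.

Lemma subspaceB u v : W u -> W v -> W (u - v).
Proof.
by move=> Wu Wv; rewrite -scaleN1r; apply: subspaceD => //; apply: subspaceZ.
Qed.

Lemma subspace_sum (I : eqType) (r : seq I) (F : I -> V) :
  (forall i, i \in r -> W (F i)) -> W (\sum_(i <- r) F i).
Proof.
elim: r => [|i r IH] H; first by rewrite big_nil; case: sW.
rewrite big_cons; apply: subspaceD; first by apply: H; rewrite mem_head.
by apply: IH => j jr; apply: H; rewrite in_cons jr orbT.
Qed.

Lemma subspaceZK (c : k) v : c != 0 -> W (c *: v) -> W v.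
Proof. by move=> c0 /(subspaceZ c^-1); rewrite scalerA mulVf // scale1r. Qed.

End Subspaces.

Section LinearSpan.
Variables (k : fieldType) (V : lmodType k) (S : V -> Prop).

Lemma lspan_sum (I : eqType) (r : seq I) (a : I -> k) (F : I -> V) :
  (forall i, i \in r -> S (F i)) -> lspan S (\sum_(i <- r) a i *: F i).
Proof.
(* In [lspan] a coefficient depends only on the vector, so the coefficients of all indices with the
   same value under [F] are added up. *)
move=> SF; exists (undup (map F r)), (fun v => \sum_(i <- r | F i == v) a i).
split=> [v|]; first by rewrite mem_undup => /mapP[i ir ->]; apply: SF.
under [RHS]eq_bigr => v _ do rewrite scaler_suml.
rewrite (exchange_big_dep xpredT) //=; apply: eq_big_seq => i ir.
rewrite big_mkcond (bigD1_seq (F i)) ?undup_uniq ?mem_undup ?map_f //=.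
by rewrite eqxx big1 ?addr0 // => v ne; rewrite eq_sym (negbTE ne).
Qed.

Lemma lspan_subspace : subspace (lspan S).
Proof.
split=> [|u v [s [c [Ss ->]]] [t [d [St ->]]]|c v [s [d [Ss ->]]]].
- by exists [::], (fun=> 0); rewrite big_nil.
- pose r := [seq (c v, v) | v <- s] ++ [seq (d v, v) | v <- t].
  have -> : \sum_(v <- s) c v *: v + \sum_(v <- t) d v *: v =
            \sum_(p <- r) p.1 *: p.2 by rewrite big_cat !big_map.
  apply: lspan_sum => p; rewrite mem_cat => /orP[] /mapP[x xs ->].
    exact: Ss.
  exact: St.
rewrite scaler_sumr; under eq_bigr => x _ do rewrite scalerA.
exact: (lspan_sum (fun x => c * d x)).
Qed.

Lemma lspan_mem v : S v -> lspan S v.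
Proof.
move=> Sv; exists [:: v], (fun=> 1); rewrite big_seq1 scale1r.
by split=> // w; rewrite inE => /eqP ->.
Qed.

End LinearSpan.

Lemma seq_mset_cons (K : choiceType) (a : K) s :
  seq_mset (a :: s) = a +` seq_mset s.
Proof. by apply/msetP => b; rewrite mset1DE !mset_seqE /= eq_sym. Qed.

Lemma seq_mset_cat (K : choiceType) (s t : seq K) :
  seq_mset (s ++ t) = seq_mset s `+` seq_mset t.
Proof. by apply/msetP => b; rewrite msetE2 !mset_seqE count_cat. Qed.

Lemma count_id0 (f : bitseq) : count id f = 0%N -> f = nseq (size f) false.
Proof. by elim: f => //= [] [] f IH //= /IH {1}->. Qed.

(** * Flagged words, their derivatives and products *)

Section Words.
Variable k : fieldType.
Implicit Types (a x y : letter) (s t : seq letter) (f g : bitseq).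

(* The letter flagged in [f] is the last factor of the monomial, the others
   are the commuting ones; [f] is meant to have a single flag. *)
Definition vec s f : DerPerm k :=
  mon k (seq_mset (mask (map negb f) s), head (0%N, 0%N) (mask f s)).

Fixpoint dword s : seq (seq letter) :=
  if s is a :: t then (dletter a :: t) :: map (cons a) (dword t) else [::].

Definition marks s f := (size f == size s) && (count id f == 1%N).

Lemma big_dword_cons (W : nmodType) a t (F : seq letter -> W) :
  \sum_(s <- dword (a :: t)) F s =
  F (dletter a :: t) + \sum_(s <- dword t) F (a :: s).
Proof. by rewrite /= big_cons big_map. Qed.

Lemma size_dword s t : t \in dword s -> size t = size s.
Proof.
elim: s t => //= a s IH t; rewrite in_cons => /predU1P[-> //|/mapP[t' t's ->]].
by rewrite /= (IH t').
Qed.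

Lemma vec_cons_false a s f :
  vec (a :: s) (false :: f) = mul (gen k a) (vec s f).
Proof. by rewrite /vec mul_mon /mulm /= mset0D seq_mset_cons. Qed.

Lemma vec_cons_true a s f : size f = size s -> count id f = 0%N ->
  vec (a :: s) (true :: f) = mon k (seq_mset s, a).
Proof.
move=> sz /count_id0 ->; rewrite /vec /= map_nseq sz mask_true //.
Qed.

Lemma der_mon_seq s a :
  der (mon k (seq_mset s, a)) =
  mon k (seq_mset s, dletter a) + \sum_(t <- dword s) mon k (seq_mset t, a).
Proof.
have e0 : seq_mset [::] = mset0 :> {mset letter}.
  by apply/msetP => x; rewrite mset_seqE mset0E.
elim: s => [|b s IH]; first by rewrite big_nil addr0 e0 der_gen.
have E c t : mon k (seq_mset (b :: t), c) = mul (gen k b) (mon k (seq_mset t, c)).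
  by rewrite /vec mul_mon /mulm /= mset0D seq_mset_cons.
rewrite E (dpa_leibniz (DerPerm_axioms k)) IH (lin_add _ _ (mul_linr _)) -E.
rewrite (lin_sum _ _ (mul_linr _)) big_dword_cons addrCA; congr (_ + (_ + _)).
  by rewrite der_gen mul_mon /mulm /= mset0D seq_mset_cons.
by apply: eq_bigr => t _; rewrite E.
Qed.

(** The Leibniz rule treats the flagged position like any other, so differentiation acts on the word
    alone and leaves the flag in place. *)
Lemma der_vec s f : marks s f ->
  der (vec s f) = \sum_(t <- dword s) vec t f.
Proof.
elim: s f => [|a s IH] [|[] f] // /andP[/= /eqP[sz]] /=.
  rewrite add1n => /eqP[c0]; rewrite (vec_cons_true _ sz c0) der_mon_seq big_cons.
  rewrite (vec_cons_true _ sz c0) big_map.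
  apply: congr1; apply: eq_big_seq => t ts.
  have szt : size f = size t by rewrite (size_dword ts).
  by rewrite (vec_cons_true _ szt c0).
rewrite add0n => c1; rewrite vec_cons_false (dpa_leibniz (DerPerm_axioms k)).
rewrite big_cons vec_cons_false der_gen; apply: congr1.
rewrite IH /marks ?sz ?eqxx // (lin_sum _ _ (mul_linr _)) big_map.
by apply: eq_bigr => t _; rewrite vec_cons_false.
Qed.

Lemma perm_mask_negb (T : eqType) (s : seq T) f : size f = size s ->
  perm_eq (mask (map negb f) s ++ mask f s) s.
Proof.
elim: s f => [|a s IH] [|[] f] //= [sz]; last by rewrite perm_cons IH.
by rewrite perm_catC /= perm_cons perm_catC IH.
Qed.

Lemma size_mask_marks s f : marks s f -> exists a, mask f s = [:: a].
Proof.
case/andP=> /eqP sz /eqP c1; have := size_mask sz; rewrite c1.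
by case: (mask f s) => [|a []] // _; exists a.
Qed.

(** Blocks may be moved together with their flags: the unflagged letters form a multiset, and with a
    single flag the list of flagged letters is a singleton, which no permutation changes. *)
Lemma vec_swap s1 s2 s3 f1 f2 f3 :
  size f1 = size s1 -> size f2 = size s2 ->
  marks (s1 ++ s2 ++ s3) (f1 ++ f2 ++ f3) ->
  vec (s1 ++ s2 ++ s3) (f1 ++ f2 ++ f3) = vec (s2 ++ s1 ++ s3) (f2 ++ f1 ++ f3).
Proof.
move=> z1 z2 ms; rewrite /vec.
have /eq_seq_msetP -> : perm_eq
    (mask (map negb (f1 ++ f2 ++ f3)) (s1 ++ s2 ++ s3))
    (mask (map negb (f2 ++ f1 ++ f3)) (s2 ++ s1 ++ s3)).
  by rewrite !map_cat !mask_cat ?size_map // perm_catCA.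
have p : perm_eq (mask (f1 ++ f2 ++ f3) (s1 ++ s2 ++ s3))
                 (mask (f2 ++ f1 ++ f3) (s2 ++ s1 ++ s3)).
  by rewrite !mask_cat // perm_catCA.
have [a e] := size_mask_marks ms.
by rewrite (perm_small_eq _ p) // -(perm_size p) e.
Qed.

Lemma marks_catCA s1 s2 s3 f1 f2 f3 :
  marks (s1 ++ s2 ++ s3) (f1 ++ f2 ++ f3) =
  marks (s2 ++ s1 ++ s3) (f2 ++ f1 ++ f3).
Proof.
rewrite /marks !size_cat !count_cat addnCA (addnCA (size s1)).
by rewrite (addnCA (count id f1)).
Qed.

Lemma vec_swap01 x y s b c f : marks (x :: y :: s) (b :: c :: f) ->
  vec (x :: y :: s) (b :: c :: f) = vec (y :: x :: s) (c :: b :: f).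
Proof. exact: (@vec_swap [:: x] [:: y] s [:: b] [:: c] f). Qed.

(** In a product the last factor of the left monomial joins the commuting ones, so the left word
    loses its flag. *)
Lemma mul_vec s1 s2 f1 f2 : marks s1 f1 -> size f2 = size s2 ->
  mul (vec s1 f1) (vec s2 f2) = vec (s1 ++ s2) (nseq (size s1) false ++ f2).
Proof.
move=> m1 z2; have /andP[/eqP z1 _] := m1; rewrite mul_mon /mulm /=.
rewrite /vec map_cat map_nseq !mask_cat ?size_nseq //= mask_true // mask_false.
have [a e] := size_mask_marks m1; rewrite e seq_mset_cat.
have /eq_seq_msetP <- := perm_mask_negb z1; rewrite e seq_mset_cat msetDA.
suff -> : seq_mset [:: a] = [mset a] by [].
by apply/msetP => b; rewrite mset_seqE msetnE /= addn0 eq_sym; case: eqP.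
Qed.

End Words.

(** * Relations modulo the elements whose derivative lies in [ST] *)

Section Relations.
Variable k : fieldType.
Implicit Types (a x y z : letter) (s t : seq letter) (f : bitseq).

HB.instance Definition _ :=
  GRing.isLinear.Build k (DerPerm k) (DerPerm k) *:%R (@der k) (@der_lin k).

Lemma bulletE (g h : DerPerm k) : bullet g h = der (mul g h).
Proof. by rewrite (dpa_leibniz (DerPerm_axioms k)). Qed.

Lemma ST_subspace : subspace (@ST k).
Proof.
split=> [W|u v Su Sv W|c v Sv W] sW WX WM; first by case: sW.
- by apply: (subspaceD sW); [apply: Su|apply: Sv].
- by apply: (subspaceZ sW); apply: Sv.
Qed.

Lemma ST_X i : ST (X k i).
Proof. by move=> W _ WX _; apply: WX. Qed.

Lemma ST_bullet (g h : DerPerm k) : ST g -> ST h -> ST (bullet g h).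
Proof.
by move=> Sg Sh W sW WX WM; apply: (WM); [apply: Sg|apply: Sh].
Qed.

(** The reduction works modulo this subspace: it contains every product of two elements of [ST],
    because a • b = (ab)'. *)
Definition integ (g : DerPerm k) := ST (der g).

Lemma integ_subspace : subspace integ.
Proof.
have sS := ST_subspace; split=> [|u v Iu Iv|c v Iv]; rewrite /integ.
- by rewrite linear0; case: sS.
- by rewrite linearD; apply: (subspaceD sS).
- by rewrite linearZ; apply: (subspaceZ sS).
Qed.

(* Independent of the choice of the last factor. *)
Definition solved s := forall f, marks s f -> integ (vec k s f).

Definition order s : nat := sumn (map snd s).

(* Weight -2. *)
Definition balanced s := (order s).+2 == size s.

(** Encodes a sum of words such as v' without fixing which position is last, so that it can serve as
    either factor of a product. The length m + 1 keeps the words nonempty, hence able to carry a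
    flag. *)
Definition flag_stable m (L : seq (seq letter)) :=
  (forall s, s \in L -> size s = m.+1) /\
  forall f, size f = m.+1 -> count id f = 1%N ->
    ST (\sum_(s <- L) vec k s f).

Lemma flag_stable_zero a : a.2 = 0%N -> flag_stable 0 [:: [:: a]].
Proof.
case: a => i _ /= ->; split=> [s|[|[] [|? ?]] //]; first by rewrite inE => /eqP ->.
rewrite big_seq1 vec_cons_true //= => _ _.
suff -> : seq_mset [::] = mset0 :> {mset letter} by apply: ST_X.
by apply/msetP => x; rewrite mset_seqE mset0E.
Qed.

(** Through this lemma an already solved word v supplies a factor v' for new relations. *)
Lemma flag_stable_dword s m : size s = m.+1 -> solved s ->
  flag_stable m (dword s).
Proof.
move=> sz Vs; split=> [t /size_dword -> //|f szf c1].
have ms : marks s f by rewrite /marks szf sz c1 !eqxx.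
by rewrite -der_vec //; apply: Vs.
Qed.

Lemma mul_sum (I J : eqType) (L1 : seq I) (L2 : seq J) (F : I -> DerPerm k) G :
  mul (\sum_(i <- L1) F i) (\sum_(j <- L2) G j) =
  \sum_(i <- L1) \sum_(j <- L2) mul (F i) (G j).
Proof.
rewrite (lin_sum _ _ (mul_linl _)); apply: eq_bigr => i _.
by rewrite (lin_sum _ _ (mul_linr _)).
Qed.

(** The single flag of [f] lies in one of the two blocks; the factor of that block is taken as the
    right factor of the product. *)
Lemma flag_stable_mul m1 m2 L1 L2 f :
  flag_stable m1 L1 -> flag_stable m2 L2 ->
  size f = (m1.+1 + m2.+1)%N -> count id f = 1%N ->
  integ (\sum_(s <- L1) \sum_(t <- L2) vec k (s ++ t) f).
Proof.
move=> [z1 S1] [z2 S2] szf.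
rewrite -(cat_take_drop m1.+1 f); set f1 := take _ _; set f2 := drop _ _.
have sf1 : size f1 = m1.+1 by rewrite size_takel // szf leq_addr.
have sf2 : size f2 = m2.+1 by rewrite size_drop szf addKn.
(* The left factor loses its flag in the product, so any flag will do for it; the first position is
   chosen. *)
pose flag m := true :: nseq m false.
have sflag m : size (flag m) = m.+1 by rewrite /= size_nseq.
have cflag m : count id (flag m) = 1%N by rewrite /= count_nseq mul0n.
rewrite count_cat => c1; case: (posnP (count id f1)) => [c0|c0].
  have c2 : count id f2 = 1%N by rewrite c0 in c1.
  have := ST_bullet (S1 _ (sflag m1) (cflag m1)) (S2 _ sf2 c2).
  rewrite bulletE mul_sum; congr (ST (der _)).
  apply: eq_big_seq => s /z1 zs; apply: eq_big_seq => t /z2 zt.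
  rewrite mul_vec ?sf2 ?zt // /marks ?sflag ?zs ?cflag ?eqxx //.
  by rewrite (count_id0 c0) sf1.
have [c2 c3] : count id f1 = 1%N /\ count id f2 = 0%N.
  by move: c0 c1; case: (count id f1) => [|[|?]] // _ [].
(* The flag lies in the first block: the product is taken in the opposite order and [vec_swap]
   exchanges the blocks. *)
have := ST_bullet (S2 _ (sflag m2) (cflag m2)) (S1 _ sf1 c2).
rewrite bulletE mul_sum exchange_big /=; congr (ST (der _)).
apply: eq_big_seq => s /z1 zs; apply: eq_big_seq => t /z2 zt.
rewrite mul_vec ?sf1 ?zs // /marks ?sflag ?zt ?cflag ?eqxx //.
have := @vec_swap k t s [::] f2 f1 [::]; rewrite !cats0 (count_id0 c3) sf2 => -> //.
- by rewrite size_nseq zt.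
- by rewrite sf1 zs.
by rewrite /marks !size_cat !count_cat size_nseq count_nseq c2 sf1 zs zt !eqxx.
Qed.

(** The relation x . v' = 0: a letter of order 0 is a generator, and v' is in [ST] because v is
    solved. *)
Lemma integ_head_zero x s f : x.2 = 0%N -> (0 < size s)%N -> solved s ->
  marks (x :: s) f -> integ (\sum_(t <- dword s) vec k (x :: t) f).
Proof.
case: s => // a s x0 _ Vs /andP[/eqP sz /eqP c1].
have := flag_stable_mul (flag_stable_zero x0)
  (@flag_stable_dword (a :: s) (size s) erefl Vs) sz c1.
by rewrite big_seq1.
Qed.

Lemma marks_swap01 x y s b c f :
  marks (x :: y :: s) (b :: c :: f) -> marks (y :: x :: s) (c :: b :: f).
Proof. by rewrite /marks /= addnCA. Qed.

Lemma marks_dword s t f : t \in dword s -> marks s f -> marks t f.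
Proof. by move=> ts; rewrite /marks (size_dword ts). Qed.

Lemma marks_eq_size s t f : size s = size t -> marks s f = marks t f.
Proof. by rewrite /marks => ->. Qed.

(** The relation y . v' = 0 for v = x s, with the term that differentiates x split off and y carried
    to the second place together with its flag. *)
Lemma integ_second_zero x y s f : y.2 = 0%N -> solved (x :: s) ->
  marks (x :: y :: s) f ->
  integ (vec k (dletter x :: y :: s) f + \sum_(t <- dword s) vec k (x :: y :: t) f).
Proof.
case: f => [|b [|c f]] // y0 Vs m1.
have m2 := marks_swap01 m1.
have := integ_head_zero y0 _ Vs m2; rewrite big_dword_cons.
rewrite vec_swap01 //; move=> /(_ erefl); congr (integ (_ + _)).
apply: eq_big_seq => t ts; rewrite vec_swap01 //.
by rewrite (marks_eq_size (t := y :: x :: s)) //= (size_dword ts).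
Qed.

Lemma solved_catCA s1 s2 s3 : solved (s1 ++ s2 ++ s3) -> solved (s2 ++ s1 ++ s3).
Proof.
move=> V f mf; have /andP[/eqP]:= mf; rewrite !size_cat => sz _.
rewrite -(cat_take_drop (size s2) f) in mf *.
rewrite -(cat_take_drop (size s1) (drop (size s2) f)) in mf *.
rewrite vec_swap ?size_takel ?size_drop //; [|lia..].
by apply: V; rewrite marks_catCA.
Qed.

Lemma solved_perm s t : perm_eq s t -> solved s -> solved t.
Proof. exact: (catCA_perm_ind solved_catCA). Qed.

End Relations.

(** * Every word of weight -2 is solved *)

Section Balanced.
Variable k : fieldType.
Implicit Types (a x y z : letter) (s t : seq letter) (f : bitseq).

Let sI := integ_subspace k.

Lemma solved_pair x y : x.2 = 0%N -> y.2 = 0%N -> solved k [:: x; y].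
Proof.
move=> x0 y0 f /andP[/eqP sz /eqP c1].
have := flag_stable_mul (flag_stable_zero k x0) (flag_stable_zero k y0) sz c1.
by rewrite !big_seq1.
Qed.

(** The relation (x y)' v' = 0, where (x y)' = x' y + x y' is in [ST] as the product x • y. *)
Lemma integ_two_zeros x y s f : x.2 = 0%N -> y.2 = 0%N -> (0 < size s)%N ->
  solved k s -> marks (x :: y :: s) f ->
  integ (\sum_(t <- dword s)
    (vec k (dletter x :: y :: t) f + vec k (x :: dletter y :: t) f)).
Proof.
case: s => // a s x0 y0 _ Vs /andP[/eqP sz /eqP c1].
have := flag_stable_mul
  (@flag_stable_dword k [:: x; y] 1 erefl (solved_pair x0 y0))
  (@flag_stable_dword k (a :: s) (size s) erefl Vs) sz c1.
by rewrite [dword [:: x; y]]/= big_cons big_seq1 -big_split.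
Qed.

Definition solved_below n := forall s, (size s < n)%N -> balanced s -> solved k s.

Lemma order_cons a s : order (a :: s) = (a.2 + order s)%N.
Proof. by []. Qed.

Lemma perm_order s t : perm_eq s t -> order s = order t.
Proof. by move=> st; apply/perm_sumn/perm_map. Qed.

Lemma perm_size_word s t : perm_eq s t -> size s = size t.
Proof. exact: perm_size. Qed.

Lemma order_dword s t : t \in dword s ->
  order t = (order s).+1.
Proof.
elim: s t => //= b s IH t; rewrite in_cons => /predU1P[-> //|/mapP[t' t's ->]].
by rewrite !order_cons (IH _ t's) addnS.
Qed.

Lemma balanced_dword a s t : (order s).+3 = size (a :: s) ->
  a.2 = 0%N -> t \in dword s -> balanced (a :: t).
Proof.
move=> + a0 ts; rewrite /balanced ?order_cons /= a0 add0n (size_dword ts) => -[<-].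
by rewrite (order_dword ts).
Qed.

Hypothesis two_neq0 : 2%:R != 0 :> k.

(** The sum of the two hypotheses is 2 g, and the characteristic is not 2. *)
Lemma integ_double (g h : DerPerm k) : integ (g + h) -> integ (g - h) -> integ g.
Proof.
move=> sum diff; apply: (subspaceZK sI two_neq0).
suff -> : 2%:R *: g = (g + h) + (g - h) by apply: (subspaceD sI).
by rewrite scaler_nat addrACA subrr addr0.
Qed.

(* With s = a_1 ... a_r and s_l its l-th derivative: (x y)' s' gives
   sum_l (x' y s_l + x y' s_l) = 0; the relations for x and y against the words
   x y s_l give x' y s_l = x y' s_l; hence sum_l x' y s_l = 0, and the relation
   for y against x' s then gives x'' y s = 0. *)
Lemma solved_order_two x y s : x.2 = 0%N -> y.2 = 0%N ->
  (order s).+2 = size s ->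
  solved_below (size (x :: y :: s)) ->
  solved k (dletter (dletter x) :: y :: s).
Proof.
move=> x0 y0 bal IH f mf.
have s_gt0 : (0 < size s)%N by rewrite -bal.
have Vs : solved k s by apply: IH; rewrite /balanced ?bal //= ltnS leqnSn.
have Vx : solved k (dletter x :: s).
  by apply: IH; rewrite /balanced ?order_cons //= x0 -bal.
have B1 := integ_second_zero y0 Vx mf.
suff B2 : integ (\sum_(t <- dword s) vec k (dletter x :: y :: t) f).
  by have := subspaceB sI B1 B2; rewrite addrK.
have B3 := integ_two_zeros x0 y0 s_gt0 Vs mf.
rewrite big_split in B3; apply: (integ_double B3).
rewrite -sumrB; apply: (subspace_sum sI) => t ts.
have szt := size_dword ts.
have Vxt : solved k (x :: t).
  apply: IH; first by rewrite /= szt.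
  by apply: balanced_dword x0 ts; rewrite bal.
have Vyt : solved k (y :: t).
  apply: IH; first by rewrite /= szt.
  by apply: balanced_dword y0 ts; rewrite bal.
have mt : marks (x :: y :: t) f by rewrite (marks_eq_size _ (t := x :: y :: s)) //= szt.
have C1 := integ_second_zero y0 Vxt mt.
have C2 := integ_head_zero (s := y :: t) x0 erefl Vyt mt.
rewrite big_dword_cons in C2.
by have := subspaceB sI C1 C2; rewrite opprD addrACA subrr addr0.
Qed.

Lemma mem_order0 s : (order s < size s)%N ->
  exists2 x : letter, x.2 = 0%N & exists t : seq letter, perm_eq s (x :: t).
Proof.
move=> lt; have /hasP[x xs /eqP x0] : has (fun a : letter => a.2 == 0%N) s.
  elim: s lt => //= a s IH; case: eqP => //= a0 lt; apply: IH.
  by move: lt a0; rewrite order_cons; lia.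
by exists x => //; exists (rem x s); apply: perm_to_rem.
Qed.

(** Induction on the order of a, with [solved_order_two] as base. Weight -2 provides a letter y of
    order 0 in s, say s = y t. Writing a = b', the relation for y against the shorter word b t
    expresses a y t through words that still contain b, whose order is one less; these have the same
    length and are solved by induction on the order. *)
Lemma solved_order_ge2 m a s : a.2 = m.+2 -> balanced (a :: s) ->
  solved_below (size (a :: s)) -> solved k (a :: s).
Proof.
elim: m a s => [|m IHm] a s am bal IH;
have /mem_order0[y y0 [t st]] : (order s < size s)%N.
- by move/eqP: bal; rewrite /= order_cons am; lia.
- have [x [x0 ->]] : exists x : letter, x.2 = 0%N /\ a = dletter (dletter x).
    by exists (a.1, 0%N); split=> //; case: (a) am => i j /= ->.
  have st' : perm_eq (dletter (dletter x) :: y :: t) (dletter (dletter x) :: s).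
    by rewrite perm_cons perm_sym.
  apply: (solved_perm st'); apply: solved_order_two => //.
    move/eqP: bal; rewrite /= order_cons am (perm_order st) (perm_size_word st) /= order_cons y0.
    by lia.
  by move: IH; rewrite /= (perm_size_word st).
- by move/eqP: bal; rewrite /= order_cons am; lia.
have [b [bm ab]] : exists b : letter, b.2 = m.+2 /\ a = dletter b.
  by exists (a.1, m.+2); split=> //; case: (a) am => i j /= ->.
have sz := perm_size_word st; have sm := perm_order st.
move/eqP: bal; rewrite /= order_cons am sm sz /= order_cons y0 => bal.
have st' : perm_eq (dletter b :: y :: t) (a :: s) by rewrite ab perm_cons perm_sym.
apply: (solved_perm st') => f mf.
have Vb : solved k (b :: t).
  by apply: IH; rewrite /balanced ?order_cons /= ?sz ?bm ?order_cons //; apply/eqP; lia.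
have := integ_second_zero y0 Vb mf.
suff B : integ (\sum_(t0 <- dword t) vec k (b :: y :: t0) f).
  by move/(subspaceB sI)/(_ B); rewrite addrK.
apply: (subspace_sum sI) => u ut; have szu := size_dword ut.
apply: IHm => //.
- by rewrite /balanced ?order_cons /= y0 bm szu (order_dword ut); apply/eqP; lia.
- by move: IH; rewrite /= sz szu.
by rewrite (marks_eq_size _ (t := dletter b :: y :: t)) //= szu.
Qed.

Lemma order_all1 s : all (fun a : letter => a.2 == 1)%N s -> order s = size s.
Proof. by elim: s => //= a s IH /andP[/eqP a1 /IH sz]; rewrite order_cons a1 sz. Qed.

Lemma dword_order2 s t : all (fun a : letter => a.2 == 1)%N s ->
  t \in dword s -> exists2 a : letter, a \in t & a.2 = 2%N.
Proof.
elim: s t => //= b s IH t /andP[/eqP b1 s1].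
rewrite in_cons => /predU1P[->|/mapP[t' t's ->]].
  by exists (dletter b); rewrite ?mem_head //= b1.
by have [a at' a2] := IH t' s1 t's; exists a; rewrite // in_cons at' orbT.
Qed.

(* Words with a letter of order at least 2 being solved, the relations against
   x, y and z say that x' y z, x y' z and x y z' have pairwise zero sums. *)
Lemma solved_order_le1 x y z s : x.2 = 0%N -> y.2 = 0%N -> z.2 = 0%N ->
  all (fun a : letter => a.2 == 1)%N s ->
  solved_below (size [:: x, y, z & s]) ->
  solved k [:: dletter x, y, z & s].
Proof.
move=> x0 y0 z0 s1 IH [|b1 [|b2 [|b3 f]]] // mf; have bal := order_all1 s1.
have R p q r c : p.2 = 0%N -> q.2 = 0%N -> r.2 = 0%N ->
    marks [:: r, p, q & s] c ->
    integ (vec k [:: r, dletter p, q & s] c + vec k [:: r, p, dletter q & s] c).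
  move=> p0 q0 r0 mc.
  have Vpq : solved k [:: p, q & s].
    by apply: IH; rewrite //= /balanced !order_cons /= p0 q0 bal.
  have := integ_head_zero (s := [:: p, q & s]) r0 erefl Vpq mc.
  rewrite !big_dword_cons addrA.
  suff B : integ (\sum_(t <- dword s) vec k [:: r, p, q & t] c).
    by move/(subspaceB sI)/(_ B); rewrite addrK.
  apply: (subspace_sum sI) => t ts; have szt := size_dword ts.
  have [a at_ a2] := dword_order2 s1 ts.
  have V : solved k [:: r, p, q & t].
    have pa : perm_eq (a :: [:: r, p, q & rem a t]) [:: r, p, q & t].
      apply/permP => c'; have /permP/(_ c') := perm_to_rem at_.
      by rewrite /= => ->; lia.
    apply: (solved_perm pa); apply: solved_order_ge2 a2 _ _.
      rewrite /balanced (perm_order pa) (perm_size_word pa) !order_cons p0 q0 r0.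
      by rewrite (order_dword ts) bal /= szt.
    by rewrite (perm_size_word pa) /= szt.
  by apply: V; rewrite (marks_eq_size _ (t := [:: r, p, q & s])) //= szt.
set T1 := vec _ _ _.
pose T2 := vec k [:: x, dletter y, z & s] [:: b1, b2, b3 & f].
pose T3 := vec k [:: x, y, dletter z & s] [:: b1, b2, b3 & f].
have R23 : integ (T2 + T3) by apply: R.
have R13 : integ (T1 + T3).
  rewrite /T1 /T3 (vec_swap01 k mf).
  rewrite (@vec_swap01 k x y _ b1 b2 (b3 :: f)) //.
  by apply: R => //; exact: (marks_swap01 mf).
have R12 : integ (T1 + T2).
  rewrite /T1 /T2.
  have E := @vec_swap k [:: _; _] [:: z] s [:: b1; b2] [:: b3] f erefl erefl.
  rewrite (E (dletter x) y mf) (E x (dletter y) mf).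
  apply: R => //; move: mf; rewrite (@marks_catCA [:: _; _] [:: z] s [:: b1; b2] [:: b3] f).
  by [].
apply: (integ_double R13).
by have := subspaceB sI R12 R23; rewrite opprD addrA addrK.
Qed.

(** Strong induction on the length. A letter of order at least 2 is handled by [solved_order_ge2].
    Otherwise there are exactly two letters of order 0, and either the word consists of these alone
    or a letter of order 1 is moved to the front for [solved_order_le1]. *)
Lemma solved_balanced s : balanced s -> solved k s.
Proof.
have [n] := ubnP (size s); elim: n s => // n IHn s; rewrite ltnS => sn bal.
have IH m : (m <= n)%N -> solved_below m.
  by move=> mn t tm; apply: IHn; apply: leq_trans mn.
have [/hasP[a as_ a2]|/hasPn s_lt2] := boolP (has (fun a : letter => 2 <= a.2)%N s).
  have pa := perm_to_rem as_; rewrite perm_sym in pa.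
  apply: (solved_perm pa); have [m am] : exists m, a.2 = m.+2.
    by case: (a.2) a2 => [|[|m]] // _; exists m.
  apply: (solved_order_ge2 am).
    by rewrite /balanced (perm_order pa) (perm_size_word pa).
  by apply: IH; rewrite (perm_size_word pa).
pose p := fun a : letter => a.2 == 1%N.
have pp : perm_eq (filter p s ++ filter (predC p) s) s by apply/permPl/perm_filterC.
have all1 := filter_all p s; have o1 := order_all1 all1.
have all0 : all (fun a : letter => a.2 == 0%N) (filter (predC p) s).
  apply/allP => a; rewrite mem_filter /= /p => /andP[pa /s_lt2].
  by case: (a.2) pa => [|[]].
have o0 : order (filter (predC p) s) = 0%N.
  by elim: (filter _ _) all0 => //= a t IHt /andP[/eqP a0 /IHt ot]; rewrite order_cons a0 ot.
(* The total order is the number of letters of order 1, and weight -2 says that the length exceeds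
   it by 2. *)
have sz0 : size (filter (predC p) s) = 2%N.
  move: bal; rewrite /balanced -(perm_order pp) -(perm_size_word pp) /order map_cat.
  rewrite sumn_cat -!/(order _) o1 o0 size_cat; lia.
have sn' : (size (filter p s ++ filter (predC p) s) <= n)%N by rewrite (perm_size_word pp).
apply: (solved_perm pp).
move: sn' sz0 all0 all1; case: (filter (predC p) s) => [|x [|y []]] //= + _.
case: (filter p s) => [|a t] sn' /and3P[/eqP x0 /eqP y0 _].
  by move=> _; apply: solved_pair.
move=> /andP[/eqP a1 t1].
have [z [z0 az]] : exists z : letter, z.2 = 0%N /\ a = dletter z.
  by exists (a.1, 0%N); split=> //; case: (a) a1 => i j /= ->.
have pa : perm_eq [:: dletter z, x, y & t] ((a :: t) ++ [:: x; y]).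
  by rewrite az /= perm_cons perm_sym (perm_catC t [:: x; y]).
apply: (solved_perm pa); apply: solved_order_le1 => //.
by apply: IH; move: sn'; rewrite size_cat /= addn2.
Qed.
End Balanced.

(** * Weights, triangularity and the basis of [ST] *)

Section Basis.
Variable k : fieldType.
Implicit Types (a : letter) (u v w : monom) (s t : seq letter).

Lemma vec_letters u :
  vec k (letters u) (rcons (nseq (size u.1) false) true) = mon k u.
Proof.
rewrite /vec /letters map_rcons map_nseq -!cats1 !mask_cat ?size_nseq //.
by rewrite mask_true // mask_false /= cats0 seq_mset_id; case: u.
Qed.

Lemma marks_letters u : marks (letters u) (rcons (nseq (size u.1) false) true).
Proof.
by rewrite /marks !size_rcons size_nseq eqxx -cats1 count_cat count_nseq mul0n.
Qed.

Lemma wtE u : wt u = (order (letters u))%:Z - (degree u)%:Z.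
Proof.
rewrite /wt /degree; elim: (letters u) => [|a s IH]; first by rewrite big_nil.
rewrite big_cons IH order_cons /= PoszD -addn1 PoszD; lia.
Qed.

Lemma vecE s f : marks s f -> exists2 u, vec k s f = mon k u & perm_eq (letters u) s.
Proof.
move=> ms; have [a e] := size_mask_marks ms; have /andP[/eqP sz _] := ms.
exists (seq_mset (mask (map negb f) s), a); first by rewrite /vec e.
rewrite /letters /= -cats1; apply: perm_trans (perm_mask_negb sz).
by rewrite e perm_cat2r perm_eq_seq_mset.
Qed.

Definition supported (P : monom -> Prop) (g : DerPerm k) :=
  forall u, u \in msupp g -> P u.

Lemma supported_subspace P : subspace (supported P).
Proof.
split=> [u|g h Pg Ph u|c g Pg u]; first by rewrite msupp0.
  by move/(fsubsetP (msuppD_le _ _)); rewrite in_fsetU => /orP[/Pg|/Ph].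
by move/(fsubsetP (msuppZ_le _ _))/Pg.
Qed.

Lemma supported_mon (P : monom -> Prop) u : P u -> supported P (mon k u).
Proof. by move=> Pu v; rewrite msuppU oner_eq0 inE => /eqP ->. Qed.

Lemma supported_der u : supported (fun v =>
  exists2 t, t \in dword (letters u) & perm_eq (letters v) t) (der (mon k u)).
Proof.
rewrite -vec_letters (der_vec k (marks_letters u)).
apply: (subspace_sum (supported_subspace _)) => t ts.
have mt := marks_dword ts (marks_letters u).
have [v -> pv] := vecE mt; apply: supported_mon; by exists t.
Qed.

Lemma wt_dword u v t : t \in dword (letters u) -> perm_eq (letters v) t ->
  wt v = wt u + 1.
Proof.
move=> tu pv; rewrite !wtE /degree (perm_size pv) (size_dword tu) (perm_order pv).
by rewrite (order_dword tu); lia.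
Qed.

Lemma perm_letters_mulm u v :
  perm_eq (letters (mulm u v)) (letters u ++ letters v).
Proof.
apply/permP => p; rewrite /letters count_cat -!cats1 !count_cat /=.
have /permP -> := perm_enum_msetD u.1 (u.2 +` v.1); rewrite count_cat.
have /permP -> := perm_enum_msetD [mset u.2] v.1; rewrite count_cat enum_msetn /=.
by lia.
Qed.

Lemma wt_mulm u v : wt (mulm u v) = wt u + wt v.
Proof. by rewrite /wt (perm_big _ (perm_letters_mulm u v)) big_cat. Qed.

Lemma supported_mul (P Q R : monom -> Prop) (g h : DerPerm k) :
  (forall u v, P u -> Q v -> R (mulm u v)) ->
  supported P g -> supported Q h -> supported R (mul g h).
Proof.
move=> PQR Pg Qh; rewrite /mul /lin_ext; have sR := supported_subspace R.
apply: (subspace_sum sR) => u /Pg Pu; apply: (subspaceZ sR).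
apply: (subspace_sum sR) => v /Qh Qv; apply: (subspaceZ sR).
by apply: supported_mon; apply: PQR.
Qed.

(* The generator, or derivative of a monomial, in which [m] occurs with
   coefficient 1 and all other monomials have a last factor of smaller order. *)
Definition led (m : monom) : DerPerm k :=
  if m.2.2 is i.+1 then der (mon k (m.1, (m.2.1, i))) else mon k m.

Lemma der_led u : der (mon k u) = led (u.1, dletter u.2).
Proof. by case: u => U [i j]. Qed.

(** Differentiating a commuting factor does not raise the order of the last one, so only the term
    that differentiates the last factor can equal [m]. *)
Lemma led_coef m : (led m)@_m = 1.
Proof.
case: m => U [i [|j]]; rewrite /led /=; first by rewrite mcoeffUU.
rewrite der_mon /derm mcoeffD mcoeffUU raddf_sum /= big1 ?add0r // => a _.
by rewrite mcoeffU; case: eqP => // -[_ /eqP]; rewrite ltn_eqF.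
Qed.

Lemma led_coef_neq0 m m' : (led m)@_m' != 0 -> m' = m \/ (m'.2.2 < m.2.2)%N.
Proof.
case: m => U [i [|j]]; rewrite /led /=.
  by rewrite mcoeffU; case: (_ =P m') => [->|_]; [left|rewrite eqxx].
rewrite der_mon /derm mcoeffD mcoeffU; case: (_ =P m') => [->|_]; first by left.
rewrite addr0 => nz; right; apply: contraNT nz; rewrite -leqNgt => lt.
rewrite raddf_sum /= big1 // => a _; rewrite /mon mcoeffU; case: eqP => // e.
by move: lt; rewrite -e /= ltnn.
Qed.

(** Equal elements would contain each other's leading monomials; were these distinct, each would
    have a last factor of smaller order than the other. *)
Lemma led_inj : injective led.
Proof.
move=> m m' e.
have [//|lt1] : m = m' \/ (m.2.2 < m'.2.2)%N.
  by apply: led_coef_neq0; rewrite -e led_coef oner_neq0.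
have [//|lt2] : m' = m \/ (m'.2.2 < m.2.2)%N.
  by apply: led_coef_neq0; rewrite e led_coef oner_neq0.
by have := ltn_trans lt1 lt2; rewrite ltnn.
Qed.

Lemma der_mon_inj : injective (fun u => der (mon k u)).
Proof.
move=> [U [i j]] [U' [i' j']]; rewrite !der_led => /led_inj[-> -> ->] //.
Qed.

(** Triangularity: at the monomial m, a linear relation only sees [led m] and those [led m'] whose
    last factor has larger order, so the coefficients vanish by descending induction on that
    order. *)
Lemma lin_indep_led (S : DerPerm k -> Prop) :
  (forall g, S g -> exists m, g = led m) -> lin_indep S.
Proof.
move=> SE s c us Ss sum0.
have [ms es] : exists ms, s = map led ms.
  elim: (s) Ss => [|g r IH] Sr; first by exists [::].
  have [m em] := SE _ (Sr g (mem_head _ _)).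
  have [|ms ems] := IH; first by move=> h hr; apply: Sr; rewrite in_cons hr orbT.
  by exists (m :: ms); rewrite em ems.
rewrite es in us sum0 *; rewrite big_map in sum0; have um := map_uniq us.
pose b := \max_(m <- ms) m.2.2.
(* [b] is the largest order of a last factor, and [d] bounds the distance to it, which turns the
   descending induction into an ascending one. *)
suff H d m : m \in ms -> (b - m.2.2 < d)%N -> c (led m) = 0.
  by move=> g /mapP[m mms ->]; apply: (H _ _ mms (ltnSn _)).
elim: d m => // d IH m mms lt.
have := congr1 (mcoeff m) sum0; rewrite mcoeff0 raddf_sum (bigD1_seq m) //=.
rewrite mcoeffZ led_coef mulr1 big1_seq ?addr0 // => m' /andP[ne m'ms].
rewrite mcoeffZ; have [->|nz] := eqVneq ((led m')@_m) 0; first by rewrite mulr0.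
have [e|lt'] := led_coef_neq0 nz; first by rewrite e eqxx in ne.
rewrite IH ?mul0r //; apply: leq_trans (_ : (b - m.2.2 <= d)%N) => //.
apply: ltn_sub2l => //; apply: leq_trans lt' _.
by rewrite /b (bigD1_seq m') //= leq_maxl.
Qed.

Lemma Sbar_led (g : DerPerm k) : Sbar g -> exists m, g = led m.
Proof.
case=> [[i ->]|[u [_ ->]]]; last by exists (u.1, dletter u.2); rewrite der_led.
by exists (mset0, (i, 0%N)).
Qed.

Lemma supported_Sbar (g : DerPerm k) :
  lspan (@Sbar k) g -> supported (fun u => wt u = -1) g.
Proof.
move=> [s [c [Ss ->]]]; have sS := supported_subspace (fun u => wt u = -1).
apply: (subspace_sum sS) => v /Ss[[i ->]|[u [wu ->]]]; apply: (subspaceZ sS).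
  by apply: supported_mon; rewrite wtE /degree /letters /= enum_mset0.
move=> v' /(supported_der (u := u))[t tu pt].
by rewrite (wt_dword tu pt) wu.
Qed.

Lemma lspan_der (g : DerPerm k) :
  supported (fun u => wt u = - 2%:Z) g -> lspan (@Sbar k) (der g).
Proof.
move=> sg; rewrite /der /lin_ext; apply: lspan_sum => u /sg wu.
by right; exists u; rewrite der_mon.
Qed.

(** By minimality of [ST], it is enough that the span is closed under the product. Its elements have
    weight -1, so a product ab has weight -2 and a • b = (ab)' is a combination of derivatives u'
    with u of weight -2. *)
Lemma STSbar (g : DerPerm k) : ST g -> lspan (@Sbar k) g.
Proof.
apply; first exact: lspan_subspace.
  by move=> i; apply: lspan_mem; left; exists i.
move=> f h /supported_Sbar wf /supported_Sbar wh; rewrite bulletE.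
apply: lspan_der; apply: (supported_mul _ wf wh) => u v wu wv.
by rewrite wt_mulm wu wv.
Qed.

Hypothesis two_neq0 : 2%:R != 0 :> k.

Lemma Sbar_ST (g : DerPerm k) : Sbar g -> ST g.
Proof.
case=> [[i ->]|[u [wu ->]]]; first exact: ST_X.
rewrite -[mon k u]vec_letters; apply: (solved_balanced two_neq0 _ (marks_letters u)).
by rewrite /balanced; move: wu; rewrite wtE /degree; lia.
Qed.

Lemma lspan_Sbar_ST (g : DerPerm k) : lspan (@Sbar k) g -> ST g.
Proof.
move=> [s [c [Ss ->]]]; have sT := ST_subspace k.
by apply: (subspace_sum sT) => v /Ss /Sbar_ST; apply: (subspaceZ sT).
Qed.

Lemma Sbar_basis : is_basis (@Sbar k) (@ST k).
Proof.
split; first exact: (lin_indep_led Sbar_led).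
by move=> g; split; [apply: STSbar|apply: lspan_Sbar_ST].
Qed.

End Basis.

(** * Counting the multilinear monomials of weight -2 *)

Section Multilinear.
Implicit Types (a : letter) (u v : monom).

(** With n letters covering n variables, no variable can repeat; this gives a boolean form of
    multilinearity. *)
Lemma multilinearP (n : nat) u :
  reflect (multilinear n u) (perm_eq [seq a.1 | a <- letters u] (iota 0 n)).
Proof.
apply: (iffP idP) => [p|[deg mem]].
  split; first by rewrite /degree -(size_map fst) (perm_size p) size_iota.
  by move=> i; rewrite (perm_mem p) mem_iota inE.
have mem' : [seq a.1 | a <- letters u] =i iota 0 n by move=> i; rewrite mem mem_iota inE.
apply: uniq_perm; rewrite ?iota_uniq //; apply: leq_size_uniq (iota_uniq 0 n) _ _.
  by move=> i; rewrite mem'.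
by rewrite size_iota size_map -deg.
Qed.

Lemma dword_vars s t : t \in dword s -> map fst t = map fst s.
Proof.
elim: s t => //= b s IH t; rewrite in_cons => /predU1P[-> //|/mapP[t' t's ->]].
by rewrite /= (IH _ t's).
Qed.

Lemma monom_eq_letters u v : u.2 = v.2 -> perm_eq (letters u) (letters v) -> u = v.
Proof.
case: u v => [U a] [V b] /= <-; rewrite /letters /= -!cats1 perm_cat2r => /eq_seq_msetP.
by rewrite !seq_mset_id => ->.
Qed.

Variable p : nat.
Let n := p.+2.

Implicit Types (t : n.-tuple 'I_p.+1) (i : 'I_n).

Definition slot t (j : 'I_n) : letter := (j : nat, tnth t j : nat).

(** A multilinear monomial is given by the variable i of its last factor and the order t_j of each
    variable j. Weight -2 makes the orders add up to n - 2 = p, so each of them fits in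
    ['I_p.+1]. *)
Definition mono (i : 'I_n) t : monom :=
  (seq_mset (map (slot t) (rem i (enum 'I_n))), slot t i).

Lemma letters_mono i t : perm_eq (letters (mono i t)) (map (slot t) (enum 'I_n)).
Proof.
have pe := perm_to_rem (mem_enum 'I_n i).
rewrite /letters -cats1 perm_sym; apply: perm_trans (perm_map (slot t) pe) _.
by rewrite /= perm_sym perm_catC /= perm_cons perm_eq_seq_mset.
Qed.

Lemma mono_inj i t i' t' : mono i t = mono i' t' -> (i, t) = (i', t').
Proof.
move=> e; congr (_, _); first by apply: val_inj; case: e.
apply: eq_from_tnth => j.
have : slot t j \in letters (mono i' t').
  by rewrite -e (perm_mem (letters_mono i t)) map_f ?mem_enum.
rewrite (perm_mem (letters_mono i' t')) => /mapP[j' _ [/val_inj <- /val_inj]].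
by [].
Qed.

Definition monos : seq monom :=
  [seq mono i t | i <- enum 'I_n,
     t <- enum [set t : n.-tuple 'I_p.+1 | (\sum_(x <- t) x)%N == p]].

(** There are n choices of the last variable and, by stars and bars, C(2p+1, p+1) tuples of p + 2
    orders with sum p. *)
Lemma size_monos : size monos = (n * 'C(p.+1 + p, p.+1))%N.
Proof. by rewrite size_allpairs size_enum_ord -cardE card_ord_partitions. Qed.

Lemma uniq_monos : uniq monos.
Proof.
apply: allpairs_uniq; rewrite ?enum_uniq // => -[i t] [i' t'] _ _.
exact: mono_inj.
Qed.

Lemma order_mono i t : order (letters (mono i t)) = (\sum_(x <- t) x)%N.
Proof.
rewrite (perm_order (letters_mono i t)) /order -map_comp sumnE big_map big_enum /=.
by rewrite big_tuple.
Qed.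

Lemma mem_monos u :
  (u \in monos) =
  perm_eq [seq a.1 | a <- letters u] (iota 0 n) && (order (letters u) == p).
Proof.
apply/allpairsP/andP => [[[i t] /= [_]]|[pu /eqP ou]].
  rewrite mem_enum inE => /eqP tp ->; rewrite order_mono tp eqxx; split=> //.
  apply: perm_trans (perm_map fst (letters_mono i t)) _.
  by rewrite -map_comp (_ : map _ _ = iota 0 n) //; apply: val_enum_ord.
(* Each variable occurs exactly once in [u], so [e j] reads off its order; the default of [nth] is
   never reached for j < n. *)
pose e j := (nth (0%N, 0%N) (letters u) (index j (map fst (letters u)))).2.
have uu : uniq (map fst (letters u)) by rewrite (perm_uniq pu) iota_uniq.
have eE a : a \in letters u -> a = (a.1, e a.1).
  move=> au; have ai : (index a (letters u) < size (letters u))%N by rewrite index_mem.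
  have E : index a.1 (map fst (letters u)) = index a (letters u).
    by rewrite -{1}(nth_index (0%N, 0%N) au) -(nth_map _ 0%N) // index_uniq ?size_map.
  by rewrite /e E nth_index //; case: (a).
have lu : perm_eq (letters u) [seq (j, e j) | j <- iota 0 n].
  have -> : letters u = [seq (j, e j) | j <- map fst (letters u)].
    by rewrite -map_comp -[LHS]map_id; apply/eq_in_map.
  exact: perm_map.
have lu' : perm_eq (letters u) [seq (j : nat, e j) | j : 'I_n <- enum 'I_n].
  by rewrite (map_comp (fun j => (j, e j)) val) val_enum_ord.
have ep : (\sum_(j < n) e j = p)%N.
  rewrite -ou (perm_order lu') /order -map_comp sumnE big_map big_enum //=.
have e_lt (j : 'I_n) : (e j < p.+1)%N.
  by rewrite ltnS -ep (bigD1 j) //= leq_addr.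
have u2 : u.2 \in letters u by rewrite mem_rcons mem_head.
have lt_u2 : (u.2.1 < n)%N.
  have : u.2.1 \in iota 0 n by rewrite -(perm_mem pu) map_f.
  by rewrite mem_iota.
pose t := [tuple Ordinal (e_lt j) | j < n].
have st j : slot t j = (j : nat, e j) by rewrite /slot tnth_mktuple.
exists (Ordinal lt_u2, t); split; rewrite ?mem_enum //.
  rewrite inE big_tuple; apply/eqP; rewrite -[RHS]ep.
  by apply: eq_bigr => j _; rewrite tnth_mktuple.
apply: monom_eq_letters; first by rewrite /= st /= -eE.
apply: (perm_trans lu'); rewrite perm_sym; apply: perm_trans (letters_mono _ _) _.
by rewrite (eq_map st).
Qed.

Lemma monosP u : reflect (multilinear n u /\ wt u = - 2%:Z) (u \in monos).
Proof.
rewrite mem_monos; apply: (iffP andP) => [[/multilinearP mu /eqP o]|[mu w]].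
  by split=> //; rewrite wtE o; case: mu => -> _; rewrite /n; lia.
split; first exact/multilinearP.
by move: w; rewrite wtE; case: mu => -> _; rewrite /n => w; apply/eqP; lia.
Qed.

End Multilinear.

(** * The multilinear component and its dimension *)

Section Dimension.
Variables (k : fieldType) (p : nat).
Hypothesis two_neq0 : 2%:R != 0 :> k.
Let n := p.+2.

Definition mbasis : seq (DerPerm k) := [seq der (mon k u) | u <- monos p].

(** Projection onto the multilinear part. Applied to an expansion over [Sbar] of a multilinear
    element, it keeps only the terms from [mbasis]. *)
Definition mproj : DerPerm k -> DerPerm k :=
  lin_ext (fun u => if perm_eq [seq a.1 | a <- letters u] (iota 0 n)
                    then mon k u else 0).

HB.instance Definition _ := GRing.isLinear.Build k (DerPerm k) (DerPerm k)
  *:%R mproj (lin_ext_is_linear _).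

Lemma mproj_id (g : DerPerm k) :
  supported (fun u => multilinear n u) g -> mproj g = g.
Proof.
move=> sg; rewrite [RHS]monalgE /mproj /lin_ext; apply: eq_big_seq => u.
move=> /sg /multilinearP ->.
by apply/malgP => v; rewrite mcoeffZ !mcoeffU mulrnAr mulr1.
Qed.

Lemma mproj_0 (g : DerPerm k) :
  supported (fun u => ~ multilinear n u) g -> mproj g = 0.
Proof.
move=> sg; rewrite /mproj /lin_ext big1_seq // => u /= /sg nm.
by case: (multilinearP n u) => // _; rewrite scaler0.
Qed.

Lemma multilinear_dword m u v t : t \in dword (letters u) ->
  perm_eq (letters v) t -> multilinear m v <-> multilinear m u.
Proof.
move=> tu vt; have E : perm_eq [seq a.1 | a <- letters v] [seq a.1 | a <- letters u].
  by rewrite -(dword_vars tu); apply: perm_map.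
split=> /multilinearP H; apply/multilinearP; last exact: perm_trans E _.
by rewrite perm_sym in E; apply: perm_trans E _.
Qed.

(** Differentiation changes neither the variables nor the degree, so the monomials of u' are all
    multilinear or none is, according to u. A generator has degree 1 < n and is killed. *)
Lemma mproj_Sbar (g : DerPerm k) : Sbar g ->
  mproj g = 0 \/ g \in mbasis /\ mproj g = g.
Proof.
case=> [[i ->]|[u [wu ->]]].
  left; apply: mproj_0; apply: supported_mon => -[].
  by rewrite /degree /letters /= enum_mset0.
have [mu|mu] := multilinearP n u.
  right; split; first by apply: map_f; apply/monosP.
  apply: mproj_id => v /(supported_der (u := u))[t tu vt].
  by apply/(multilinear_dword _ tu vt).
left; apply: mproj_0 => v /(supported_der (u := u))[t tu vt].
by move/(multilinear_dword _ tu vt).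
Qed.

Lemma mbasisP (g : DerPerm k) : g \in mbasis ->
  Sbar g /\ supported (fun u => multilinear n u) g.
Proof.
move=> /mapP[u /monosP[mu wu] ->]; split; first by right; exists u.
move=> v /(supported_der (u := u))[t tu vt].
by apply/(multilinear_dword _ tu vt).
Qed.

Lemma STmult_basis : is_basis (fun g => g \in mbasis) (STmult n).
Proof.
split; first by apply: lin_indep_led => g /mbasisP[/Sbar_led].
move=> g; split=> [[/STSbar[s [c [Ss eg]]] mg]|[s [c [Ss ->]]]].
  rewrite -(mproj_id mg) eg linear_sum.
  have sS := lspan_subspace (fun g : DerPerm k => g \in mbasis).
  apply: (subspace_sum sS) => v /Ss Sv.
  rewrite linearZ; apply: (subspaceZ sS); have [e|[mv e]] := mproj_Sbar Sv.
    by rewrite /= e; case: sS.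
  by rewrite /= e; apply: lspan_mem.
split.
  apply: (subspace_sum (ST_subspace k)) => v /Ss /mbasisP[Sv _].
  by apply: (subspaceZ (ST_subspace k)); apply: Sbar_ST.
have sS := supported_subspace k (fun u => multilinear n u).
by apply: (subspace_sum sS) => v /Ss /mbasisP[_ mv]; apply: (subspaceZ sS).
Qed.

Lemma STmult_dim : has_dim (@STmult k n) (n * 'C(p.+1 + p, p.+1))%N.
Proof.
have sz : size mbasis == (n * 'C(p.+1 + p, p.+1))%N by rewrite size_map size_monos.
exists (Tuple sz); split; last exact: STmult_basis.
by rewrite /= map_inj_uniq ?uniq_monos //; apply: der_mon_inj.
Qed.

End Dimension.

Theorem corollary5p4 (k : fieldType) (char0 : [pchar k]%R =i pred0) :
  is_basis (@Sbar k) (@ST k) /\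
  (forall n : nat, (2 <= n)%N ->
     has_dim (@STmult k n) (n * 'C(2 * n - 3, n - 1))%N).
Proof.
have two_neq0 : 2%:R != 0 :> k by have /pcharf0P -> := char0.
split; first exact: Sbar_basis.
(* With n = p + 2 the binomial C(2n-3, n-1) becomes C(2p+1, p+1). *)
case=> [|[|p]] // _; have := STmult_dim p two_neq0.
suff -> : (2 * p.+2 - 3 = p.+1 + p)%N by rewrite subSS subn0.
by lia.
Qed.
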